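(* Let $r\ge 1$ and $\bm{N}=(N_1,\dots,N_r)$ with $N_j\in\{1,2,\dots\}\cup\{\infty\}$. Suppose we are given sets of complex coefficients $\{a_{\bm{n},j}\}_{\bm{n}\in\mathbb{N}^r_{\bm{N}}}$ and $\{b_{\bm{n},j}\}_{\bm{n}\in\mathbb{N}^r_{\bm{N}-\bm{e}_j}}$ for each $1\le j\le r$. Assume they satisfy, for $j\ne l$, the partial difference equations \begin{align*} & b_{\bm{n}+\bm{e}_l,j}-b_{\bm{n}+\bm{e}_j,l}=b_{\bm{n},j}-b_{\bm{n},l},\\ & b_{\bm{n},l}b_{\bm{n}+\bm{e}_l,j}-b_{\bm{n},j}b_{\bm{n}+\bm{e}_j,l}=\sum_{i=1}^ra_{\bm{n}+\bm{e}_l,i}-\sum_{i=1}^ra_{\bm{n}+\bm{e}_j,i},\\ & a_{\bm{n}+\bm{e}_l,j}\left(b_{\bm{n}-\bm{e}_j,j}-b_{\bm{n}-\bm{e}_j,l}\right)=a_{\bm{n},j}\left(b_{\bm{n},j}-b_{\bm{n},l}\right) \end{align*} (each whenever all the coefficients occurring in it are defined), along with the boundary conditions (a) $a_{\bm{n},j}=0$ when $n_j=0$, (b) $a_{\bm{n},j}=0$ when $n_j=N_j$, and the normality conditions (c) $a_{\bm{n},j}\neq0$ when $0<n_j<N_j$, (d) $b_{\bm{n},j}-b_{\bm{n},k}\ne0$ when $j\neq k$. Then there is a unique perfect system $\bm{\mu}=(\mu_1,\dots,\mu_r)\in\mathcal{L}^r$ such that $a_{\bm{n},j}$ and $b_{\bm{n},j}$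 are the nearest neighbour recurrence coefficients of $\bm{\mu}$, with $\mu_j\in\mathcal{L}_{N_j}$ for each $j=1,\dots,r$.
   Context: $\mathbb{N}=\{0,1,2,\dots\}$; $\bm{e}_j$ are the standard unit vectors; $\mathbb{N}^r_{\bm{M}}=\{\bm{n}\in\mathbb{N}^r:n_j\le M_j\ \forall j\}$. A moment functional is a linear map $\mu:\mathbb{C}[x]\to\mathbb{C}$; put $\Delta_n=\det(\mu[x^{i+k}])_{i,k=0}^{n-1}$. For $N\in\{1,2,\dots\}$, $\mathcal{L}_N$ is the set of $\mu$ with $\Delta_n\ne0$ for $1\le n\le N$ and $\Delta_n=0$ for $n>N$; $\mathcal{L}_\infty$ is the set of $\mu$ with $\Delta_n\neq0$ for all $n$; $\mathcal{L}=\mathcal{L}_\infty\cup\bigcup_{N\ge1}\mathcal{L}_N$. For a system $(\mu_1,\dots,\mu_r)$ of moment functionals and $\bm{n}\in\mathbb{N}^r$, $|\bm{n}|=\sum n_j$, the index $\bm{n}$ is normal if every nonzero polynomial $P$ with $\deg P\le|\bm{n}|$ and $\mu_j[P(x)x^p]=0$ for $0\le p\le n_j-1$, $1\le j\le r$, has degree exactly $|\bm{n}|$; then $P_{\bm{n}}$ is the unique monic such polynomial. A system with $\mu_j\in\mathcal{L}_{N_j}$ is perfect if all indices in $\mathbb{N}^r_{\bm{N}}$ are normal. For a perfect system the nearest neighbour recurrence coefficients are the numbers in $xP_{\bm{n}}=P_{\bm{n}+\bm{e}_j}+b_{\bm{n},j}P_{\bm{n}}+\sum_{i=1}^ra_{\bm{n},i}P_{\bm{n}-\bm{e}_i}$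 ($\bm{n},\bm{n}+\bm{e}_j\in\mathbb{N}^r_{\bm{N}}$), with $a_{\bm{n},i}=0$ if $n_i=0$; $a_{\bm{n},i}$ does not depend on $j$, and by convention $a_{\bm{N},i}:=0$ if all $N_j$ are finite.
   Formalization: Uniqueness of the perfect system is stated up to multiplying each μ_j by a nonzero constant, since rescaling the μ_j changes neither the classes L_{N_j} nor the recurrence coefficients, so literal uniqueness fails for unnormalized moment functionals. *)

(* Defs.v *)
From HB Require Import structures.
From mathcomp Require Import all_boot all_order all_algebra.
From mathcomp Require Import boolp classical_sets reals.
From mathcomp Require Import complex.

Set Implicit Arguments.
Unset Strict Implicit.
Unset Printing Implicit Defensive.

Import Order.TTheory GRing.Theory Num.Theory.

Local Open Scope ring_scope.

(* Elements of {0, 1, 2, ...} u {oo}; None stands for oo. *)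
Definition enat := option nat.

Definition leen (n : nat) (N : enat) : bool :=
  if N is Some N' then (n <= N')%N else true.

Definition lten (n : nat) (N : enat) : bool :=
  if N is Some N' then (n < N')%N else true.

Definition mindex (r : nat) := {ffun 'I_r -> nat}.

(* n + e_j *)
Definition addu r (n : mindex r) (j : 'I_r) : mindex r :=
  [ffun i => (n i + (i == j))%N].

(* n - e_j; the subtraction is truncated, so this is n itself when n_j = 0. *)
Definition subu r (n : mindex r) (j : 'I_r) : mindex r :=
  [ffun i => (n i - (i == j))%N].

Definition mnorm r (n : mindex r) : nat := (\sum_j n j)%N.

Definition in_box r (N : 'I_r -> enat) (n : mindex r) : Prop :=
  forall j, leen (n j) (N j).

Section Functionals.
Variable R : realType.

Definition hankel_det (mu : {scalar {poly R[i]}}) (n : nat) : R[i] :=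
  \det (\matrix_(i < n, k < n) mu 'X^(i + k)%N).

Definition in_L (N : enat) (mu : {scalar {poly R[i]}}) : Prop :=
  if N is Some N' then
    (forall n, (1 <= n <= N')%N -> hankel_det mu n != 0) /\
    (forall n, (N' < n)%N -> hankel_det mu n = 0)
  else forall n, hankel_det mu n != 0.

Variable r : nat.
Implicit Types (mu : 'I_r -> {scalar {poly R[i]}}) (N : 'I_r -> enat).
Implicit Types (n : mindex r) (P : {poly R[i]}).

Definition mop_orthogonal mu n P : Prop :=
  forall (j : 'I_r) (p : nat), (p < n j)%N -> mu j (P * 'X^p) = 0.

(* "deg P = d" reads size P = d.+1. *)
Definition normal_index mu n : Prop :=
  forall P, P != 0 -> (size P <= (mnorm n).+1)%N -> mop_orthogonal mu n P ->
    size P = (mnorm n).+1.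

(* P_n; the polynomial is unique when n is normal, and the value is only
   meaningful in that case. *)
Definition mop mu n : {poly R[i]} :=
  xget 0 [set P | [/\ P \is monic, size P = (mnorm n).+1
                    & mop_orthogonal mu n P]]%classic.

Definition perfect_system N mu : Prop :=
  (forall j, in_L (N j) (mu j)) /\
  (forall n, in_box N n -> normal_index mu n).

(* a and b are total functions, but only a n j with n in the box, and b n j
   with n + e_j in the box, are constrained.  The terms of the sum with
   n_i = 0 vanish because a n i = 0. *)
Definition nn_coefficients N mu (a b : mindex r -> 'I_r -> R[i]) : Prop :=
  [/\ forall n j, in_box N (addu n j) ->
        'X * mop mu n = mop mu (addu n j) + b n j *: mop mu n
                        + \sum_(i < r) a n i *: mop mu (subu n i),
      forall n i, in_box N n -> n i = 0%N -> a n i = 0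
    & forall n, (forall j, N j = Some (n j)) -> forall i, a n i = 0].

End Functionals.

(* Main.v *)
Require Import Defs.
From HB Require Import structures.
From mathcomp Require Import all_boot all_order all_algebra.
From mathcomp Require Import ring.
From mathcomp Require Import boolp classical_sets reals.
From mathcomp Require Import complex.

(* The difference equations say exactly that the recurrence produces the same
   P_n along every lattice path from 0 to n.  On the axis of e_j it is a
   three-term recurrence, and mu_j is the Favard functional of it; when N_j is
   finite the recurrence is continued by zero coefficients, so that P_(N_j e_j)
   is annihilated together with all its multiples.  Subtracting the recurrences
   in directions j and l gives
     P_(n+e_l) = P_(n+e_j) + (b_(n,j) - b_(n,l)) P_n,
   which propagates the orthogonality from the axis of e_j to the whole box,
   and also mu_j(P_n x^(n_j)) <> 0 by condition (d); by induction along a path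
   this implies normality.  Conversely, the recurrence determines the P_n, hence
   mu_j on a basis: for finite N_j one uses that a functional in L_N
   annihilates all multiples of its N-th orthogonal polynomial. *)

Set Implicit Arguments.
Unset Strict Implicit.
Unset Printing Implicit Defensive.

Import Order.TTheory GRing.Theory Num.Theory.

Local Open Scope ring_scope.

(** * Functionals with prescribed moments *)

Section MomentFunctional.
Variables (K : fieldType) (m : nat -> K).

Definition moment_functional (p : {poly K}) : K :=
  \sum_(i < size p) p`_i * m i.

Lemma moment_functional_wide n (p : {poly K}) : (size p <= n)%N ->
  moment_functional p = \sum_(i < n) p`_i * m i.
Proof.
move=> le_pn; rewrite /moment_functional (big_ord_widen n (fun i => p`_i * m i)) //.
rewrite big_mkcond; apply: eq_bigr => i _; case: ltnP => // le_pi.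
by rewrite nth_default // mul0r.
Qed.

Fact moment_functional_is_linear : scalar moment_functional.
Proof.
move=> c p q; pose n := maxn (size p) (size q).
have [le_p le_q] : (size p <= n /\ size q <= n)%N.
  by split; [exact: leq_maxl|exact: leq_maxr].
rewrite (@moment_functional_wide n); last first.
  rewrite (leq_trans (size_polyD _ _)) // geq_max le_q andbT.
  exact: leq_trans (size_scale_leq _ _) le_p.
rewrite (moment_functional_wide le_p) (moment_functional_wide le_q).
rewrite mulr_sumr -big_split; apply: eq_bigr => i _ /=.
by rewrite coefD coefZ mulrDl mulrA.
Qed.

HB.instance Definition _ :=
  GRing.isLinear.Build K {poly K} K _ moment_functional
    moment_functional_is_linear.

Lemma moment_functionalXn n : moment_functional 'X^n = m n.
Proof.
rewrite (@moment_functional_wide n.+1) ?size_polyXn // big_ord_recr /=.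
rewrite coefXn eqxx mul1r big1 ?add0r // => i _.
by rewrite coefXn ltn_eqF ?mul0r.
Qed.

End MomentFunctional.

Lemma size_sub_monic (K : fieldType) (p q : {poly K}) :
  p != 0 -> q \is monic -> size q = size p ->
  (size (p - lead_coef p *: q)%R < size p)%N.
Proof.
move=> p_neq0 mon_q eq_qp.
have sz_q : size (lead_coef p *: q) = size p by rewrite size_scale ?lead_coef_eq0.
have le_pq : (size (p - lead_coef p *: q)%R <= size p)%N.
  by rewrite (leq_trans (size_polyD _ _)) // size_polyN sz_q maxnn.
rewrite ltn_neqAle le_pq andbT; apply/eqP => eq_pq.
have : lead_coef (p - lead_coef p *: q) = 0.
  rewrite lead_coefE eq_pq coefB coefZ -{2}eq_qp -!lead_coefE (monicP mon_q).
  by rewrite mulr1 subrr.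
by move/eqP; rewrite lead_coef_eq0 -size_poly_eq0 eq_pq size_poly_eq0 (negPf p_neq0).
Qed.

(** * Three-term recurrences and their Favard functionals *)

Section ThreeTerm.
Variables (K : fieldType) (alpha beta : nat -> K).

(** The inner [0] is the usual convention that the polynomial of index -1 vanishes. *)
Fixpoint three_term k : {poly K} :=
  if k is k'.+1 then
    ('X - (beta k')%:P) * three_term k' -
    alpha k' *: (if k' is k''.+1 then three_term k'' else 0)
  else 1.

Lemma three_term_monic_size k :
  three_term k \is monic /\ size (three_term k) = k.+1.
Proof.
suff: (three_term k \is monic /\ size (three_term k) = k.+1) /\
  (three_term k.+1 \is monic /\ size (three_term k.+1) = k.+2) by case.
elim: k => [|k [IHk [mon_k1 size_k1]]].
  by rewrite /= scaler0 subr0 mulr1 monicXsubC size_XsubC monic1 size_poly1.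
have mon : ('X - (beta k.+1)%:P) * three_term k.+1 \is monic.
  by rewrite monicMl ?monicXsubC.
have sz : size (('X - (beta k.+1)%:P) * three_term k.+1) = k.+3.
  by rewrite size_monicM ?monicXsubC ?monic_neq0 // size_XsubC size_k1.
have lt_sz : (size (- (alpha k.+1 *: three_term k)) <
    size (('X - (beta k.+1)%:P) * three_term k.+1)%R)%N.
  rewrite sz size_polyN (leq_ltn_trans (size_scale_leq _ _)) //.
  by case: IHk => _ ->.
split=> //; split; rewrite [three_term k.+2]/=.
  by rewrite monicE lead_coefDl // -monicE.
by rewrite size_polyDl.
Qed.

Lemma three_term_monic k : three_term k \is monic.
Proof. by case: (three_term_monic_size k). Qed.

Lemma size_three_term k : size (three_term k) = k.+1.
Proof. by case: (three_term_monic_size k). Qed.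

(** There is one monic [three_term k] in each degree, so removing a leading term lowers the size. *)
Lemma proportional_on_three_term c (f g : {scalar {poly K}}) :
  (forall k, f (three_term k) = c * g (three_term k)) ->
  forall p, f p = c * g p.
Proof.
move=> fg p; have [n] := ubnP (size p); elim: n p => // n IHn p lt_pn.
have [->|p_neq0] := eqVneq p 0; first by rewrite !linear0 mulr0.
pose t := three_term (size p).-1.
have lt_pt : (size (p - lead_coef p *: t)%R < size p)%N.
  apply: size_sub_monic; rewrite ?three_term_monic // size_three_term.
  by rewrite prednK // size_poly_gt0.
have := IHn _ (leq_trans lt_pt lt_pn).
by rewrite !linearB !linearZ fg /= mulrBr (mulrCA c) => /addIr.
Qed.

(* [xpow_coef p k] is the coefficient of [three_term k] in the expansion of
   ['X^p]; the functionals below are therefore the basis dual to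
   [three_term]. *)
Fixpoint xpow_coef p (k : nat) : K :=
  if p is p'.+1 then
    (if k is k'.+1 then xpow_coef p' k' else 0) +
    beta k * xpow_coef p' k + alpha k.+1 * xpow_coef p' k.+1
  else (k == 0%N)%:R.

Definition dual_functional k : {scalar {poly K}} :=
  moment_functional (fun p => xpow_coef p k).

(** This is the transpose of the recurrence: the recursion of [xpow_coef], which expresses
    multiplication by ['X] on coefficients, extended linearly from monomials. *)
Lemma dual_functionalMX k p :
  dual_functional k ('X * p) =
    (if k is k'.+1 then dual_functional k' p else 0) +
    beta k * dual_functional k p + alpha k.+1 * dual_functional k.+1 p.
Proof.
rewrite -[p]coefK poly_def mulr_sumr !linear_sum !mulr_sumr.
have -> : (if k is k'.+1 then
      dual_functional k' (\sum_(i < size p) p`_i *: 'X^i) else 0) =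
    \sum_(i < size p) p`_i * (if k is k'.+1 then xpow_coef i k' else 0).
  case: k => [|k]; first by rewrite big1 // => i _; rewrite mulr0.
  rewrite linear_sum; apply: eq_bigr => i _.
  by rewrite linearZ /= moment_functionalXn.
rewrite -!big_split; apply: eq_bigr => i _ /=.
rewrite -scalerAr -exprS !linearZ /= !moment_functionalXn /=.
by rewrite !mulrDr !(mulrCA p`_i).
Qed.

Lemma dual_functional_three_term k n :
  dual_functional k (three_term n) = (k == n)%:R.
Proof.
suff: (forall k, dual_functional k (three_term n) = (k == n)%:R) /\
      (forall k, dual_functional k (three_term n.+1) = (k == n.+1)%:R).
  by case.
have dual1 i : dual_functional i 1 = (i == 0%N)%:R.
  by rewrite -(expr0 'X) /= moment_functionalXn.
have step i m : dual_functional i (('X - (beta m)%:P) * three_term m) =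
    dual_functional i ('X * three_term m) - beta m * dual_functional i (three_term m).
  by rewrite mulrBl mul_polyC linearB linearZ.
elim: n {k} => [|n [IHn IHn1]].
  split=> k; first exact: dual1.
  have -> : three_term 1 = ('X - (beta 0%N)%:P) * three_term 0.
    by rewrite /three_term scaler0 subr0.
  rewrite step dual_functionalMX !dual1.
  by case: k => [|[|k]]; rewrite ?dual1 /= ?mulr0 ?oppr0 ?addr0 ?add0r ?subrr.
split=> // k.
have -> : three_term n.+2 = ('X - (beta n.+1)%:P) * three_term n.+1 -
    alpha n.+1 *: three_term n by [].
have -> p q c : dual_functional k (p - c *: q) =
    dual_functional k p - c * dual_functional k q by rewrite linearB linearZ.
rewrite step dual_functionalMX !IHn1 IHn.
case: k => [|k] /=; rewrite ?IHn1 ?eqSS.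
  rewrite !mulr0 add0r oppr0 addr0 add0r.
  by case: n {IHn IHn1} => [|n] /=; rewrite ?mulr0 ?oppr0 ?addr0 ?subrr.
(* The Kronecker deltas allow the indices of [beta] and [alpha] to be matched, after which the two
   recurrences cancel. *)
have -> : beta k.+1 * (k == n)%:R = beta n.+1 * (k == n)%:R.
  by have [->|_] := eqVneq k n; rewrite ?mulr0.
have -> : alpha k.+2 * (k.+1 == n)%:R = alpha n.+1 * (k.+1 == n)%:R.
  by have [<-|_] := eqVneq k.+1 n; rewrite ?mulr0.
by rewrite addrAC addrK addrK.
Qed.

Lemma three_term_MX k :
  'X * three_term k.+1 =
  three_term k.+2 + beta k.+1 *: three_term k.+1 + alpha k.+1 *: three_term k.
Proof. by rewrite [three_term k.+2]/= mulrBl mul_polyC addrAC subrK subrK. Qed.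

Section Orthogonality.
Variable f : {scalar {poly K}}.

Lemma three_term_functionalMX k p :
  f (three_term k.+1 * 'X^(p.+1)) =
  f (three_term k.+2 * 'X^p) + beta k.+1 * f (three_term k.+1 * 'X^p) +
  alpha k.+1 * f (three_term k * 'X^p).
Proof.
rewrite exprS mulrA (mulrC _ 'X) three_term_MX.
move: (three_term k.+2) (three_term k.+1) (three_term k) => u v w.
by rewrite !mulrDl -!scalerAl !linearD !linearZ.
Qed.

(** Since [alpha N = 0], the recurrence restarts at [N], and every later polynomial is a multiple of
    [three_term N]. This serves uniqueness, where [f] is not yet known to kill the later
    [three_term k]. *)
Lemma three_term_annihilated N : alpha N = 0 ->
  (forall p, f (three_term N * 'X^p) = 0) ->
  forall k p, (N <= k)%N -> f (three_term k * 'X^p) = 0.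
Proof.
move=> alphaN fN.
have step k : alpha k = 0 \/ (0 < k)%N /\ (forall p, f (three_term k.-1 * 'X^p) = 0) ->
    (forall p, f (three_term k * 'X^p) = 0) ->
    forall p, f (three_term k.+1 * 'X^p) = 0.
  move=> prev fk p.
  have -> : f (three_term k.+1 * 'X^p) =
      - alpha k * f ((if k is k'.+1 then three_term k' else 0) * 'X^p).
    rewrite [three_term k.+1]/=; move: (if k is _.+1 then _ else _) => v.
    rewrite !mulrBl mul_polyC -!scalerAl -mulrA mulrCA -exprS !linearB !linearZ.
    by rewrite !fk /= mulr0 subr0 add0r mulNr.
  case: prev => [->|]; first by rewrite oppr0 mul0r.
  by case: k {fk} => [[]|k /= [_ ->]] //; rewrite mulr0.
suff main d : (forall p, f (three_term (N + d) * 'X^p) = 0) /\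
              (forall p, f (three_term (N + d).+1 * 'X^p) = 0).
  by move=> k p /subnKC <-; case: (main (k - N)%N).
elim: d => [|d [IHd IHd1]]; rewrite ?addn0 ?addnS.
  by split=> //; apply: step => //; left.
by split=> //; apply: step => //; right.
Qed.

Hypothesis f_three_term : forall k, f (three_term k.+1) = 0.

(** Each factor ['X] traded through the recurrence lowers the index by at most one, so index [0] is
    not reached with [p < k] factors. *)
Lemma three_term_orthogonal k p : (p < k)%N -> f (three_term k * 'X^p) = 0.
Proof.
elim: p k => [|p IHp] [|k] //; first by rewrite expr0 mulr1 f_three_term.
rewrite ltnS => ltpk.
by rewrite three_term_functionalMX !IHp ?mulr0 ?addr0 // ltnW // ltnW.
Qed.

Lemma three_term_diagonal k :
  f (three_term k * 'X^k) = \prod_(i < k) alpha i.+1 * f 1.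
Proof.
elim: k => [|k IHk]; first by rewrite big_ord0 mulr1 mul1r.
rewrite three_term_functionalMX (@three_term_orthogonal k.+2) //.
rewrite (@three_term_orthogonal k.+1) // mulr0 !add0r IHk.
by rewrite big_ord_recr /= mulrA (mulrC (alpha _)).
Qed.

(** Trading factors ['X] for neighbouring indices never leads below [N], because the only downward
    term at [N] carries the factor [alpha N]. *)
Lemma three_term_terminates N k p : (0 < N <= k)%N -> alpha N = 0 ->
  f (three_term k * 'X^p) = 0.
Proof.
case: N k => [|N] [|k] //= le_Nk alphaN.
elim: p k le_Nk => [|p IHp] k le_Nk; first by rewrite expr0 mulr1 f_three_term.
rewrite three_term_functionalMX !IHp ?mulr0 ?addr0 ?add0r //; last exact: leqW.
move: le_Nk; rewrite leq_eqVlt => /predU1P [[<-]|]; first by rewrite alphaN mul0r.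
by case: k => // k le_Nk; rewrite IHp ?mulr0.
Qed.

End Orthogonality.

End ThreeTerm.

(** * Hankel determinants and the classes L_N *)

Section Hankel.
Variable R : realType.
Implicit Types (mu : {scalar {poly R[i]}}) (P : {poly R[i]}).

(** A row vector in the kernel of the Hankel matrix is the coefficient vector of such a [P]: its
    product with column [k] is [mu (P * 'X^k)]. *)
Lemma hankel_det_eq0P mu n :
  hankel_det mu n = 0 <->
  exists P, [/\ P != 0, (size P <= n)%N
              & forall p, (p < n)%N -> mu (P * 'X^p) = 0].
Proof.
rewrite /hankel_det; set H := \matrix_(_, _) _.
have vH (v : 'rV_n) (k : 'I_n) : (v *m H) 0 k = mu (rVpoly v * 'X^k).
  rewrite mxE -[rVpoly v]coefK poly_def.
  rewrite (big_ord_widen n (fun i => (rVpoly v)`_i *: 'X^i)) ?size_poly //.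
  rewrite [in RHS]big_mkcond mulr_suml linear_sum; apply: eq_bigr => i _.
  rewrite mxE; case: ltnP => [_|le_i].
    by rewrite -scalerAl linearZ /= -exprD coef_rVpoly_ord.
  by rewrite mul0r linear0 -coef_rVpoly_ord nth_default // mul0r.
split=> [/eqP/det0P [v v_neq0 vH0]|[P [P_neq0 le_Pn muP]]].
  exists (rVpoly v); split; last 1 first.
  - by move=> p lt_pn; rewrite -(vH v (Ordinal lt_pn)) vH0 mxE.
  - by apply: contra v_neq0 => /eqP v0; rewrite -[v]rVpolyK v0 linear0.
  - exact: size_poly.
apply/eqP/det0P; exists (poly_rV P); last first.
  by apply/rowP => k; rewrite vH poly_rV_K // muP // mxE.
by apply: contra P_neq0 => /eqP P0; rewrite -[P](poly_rV_K le_Pn) P0 linear0.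
Qed.

(* If [h = mu (P X^(N+k))] is the first nonzero moment of [P], then any [Q]
   in the kernel of the Hankel matrix of order [N+k+1] is a multiple [A P] of
   [P], and pairing it with [X^(N+k-deg A)] gives [h] times the leading
   coefficient of [A]. *)
Lemma in_L_annihilated mu N P : in_L (Some N) mu -> P \is monic ->
  size P = N.+1 -> (forall p, (p < N)%N -> mu (P * 'X^p) = 0) ->
  forall p, mu (P * 'X^p) = 0.
Proof.
case=> [hankel_neq0 hankel_eq0] monP sizeP muP p.
have [n] := ubnP p; elim: n p => // n IHn p lt_pn.
have {}IHn q : (q < p)%N -> mu (P * 'X^q) = 0.
  by move=> lt_qp; apply: IHn; exact: leq_trans lt_qp lt_pn.
have [/muP//|/subnKC] := ltnP p N; set k := (p - N)%N => def_p.
apply/eqP/negP => h_neq0.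
have /hankel_det_eq0P[Q [Q_neq0 le_Q muQ]] : hankel_det mu p.+1 = 0.
  by apply: hankel_eq0; rewrite ltnS -def_p leq_addr.
pose A := Q %/ P; pose B := Q %% P.
have P_neq0 := monic_neq0 monP.
have defQ : Q = A * P + B by exact: divp_eq.
have sizeB : (size B <= N)%N.
  by rewrite -ltnS -sizeP ltn_modp.
have sizeA : (size A <= k.+1)%N.
  rewrite size_divp // sizeP /= leq_subLR; apply: (leq_trans le_Q).
  by rewrite -def_p addnS.
have muAP q : (q + (size A).-1 < p)%N -> mu (A * P * 'X^q) = 0.
  move=> lt_q; rewrite -mulrA -[A]coefK poly_def mulr_suml linear_sum big1 // => i _.
  rewrite -scalerAl linearZ /= mulrCA -exprD IHn ?mulr0 //.
  apply: leq_ltn_trans lt_q; rewrite addnC leq_add2l.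
  by rewrite -ltnS prednK //; exact: leq_ltn_trans (ltn_ord i).
(* The product [A * P] has zero moments of order below [N], so the remainder [B] inherits those of
   [Q] and would make the Hankel matrix of order [N] singular. *)
have B_eq0 : B = 0.
  apply/eqP/negPn/negP => B_neq0.
  have N_gt0 : (0 < N)%N by rewrite (leq_trans _ sizeB) // size_poly_gt0.
  have /eqP[] : hankel_det mu N != 0 by apply: hankel_neq0; rewrite N_gt0 leqnn.
  apply/hankel_det_eq0P; exists B; split=> // q lt_qN.
  have := muQ q; rewrite defQ mulrDl linearD /= muAP ?add0r.
    by apply; rewrite ltnS -def_p (leq_trans (ltnW lt_qN)) // leq_addr.
  rewrite -def_p -addSn leq_add //.
  by case: (size A) sizeA.
have A_neq0 : A != 0.
  by apply: contra Q_neq0 => /eqP A0; rewrite defQ A0 B_eq0 mul0r addr0.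
have sizeA_gt0 : (0 < size A)%N by rewrite size_poly_gt0.
pose d := (size A).-1.
have le_dp : (d <= p)%N.
  by rewrite -ltnS prednK // (leq_trans sizeA) // ltnS -def_p leq_addl.
have := muQ (p - d)%N; rewrite ltnS leq_subr => /(_ isT).
rewrite defQ B_eq0 addr0 -[A]coefK poly_def -(prednK sizeA_gt0) -/d.
rewrite big_ord_recr /= !mulrDl mulr_suml mulr_suml linearD linear_sum.
rewrite big1 ?add0r; last first.
  move=> i _; rewrite -!scalerAl linearZ /= (mulrC 'X^i) -mulrA -exprD IHn ?mulr0 //.
  by rewrite -[leqRHS](subnKC le_dp) ltn_add2r.
rewrite -!scalerAl linearZ /= (mulrC 'X^d) -mulrA -exprD subnKC //.
move/eqP; rewrite mulf_eq0 (negPf (introN idP h_neq0)) orbF.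
by rewrite -lead_coefE lead_coef_eq0 (negPf A_neq0).
Qed.

End Hankel.

(** * Multi-indices, boxes and induction principles *)

Section MultiIndex.
Variable r : nat.
Implicit Types (n m : mindex r) (i j k l : 'I_r) (N : 'I_r -> enat).

Lemma adduE n j i : addu n j i = (n i + (i == j))%N.
Proof. by rewrite ffunE. Qed.

Lemma adduC n j l : addu (addu n j) l = addu (addu n l) j.
Proof. by apply/ffunP => i; rewrite !adduE addnAC. Qed.

Lemma adduK n j : subu (addu n j) j = n.
Proof. by apply/ffunP => i; rewrite !ffunE addnK. Qed.

Lemma subuK n j : (0 < n j)%N -> addu (subu n j) j = n.
Proof.
by move=> n_gt0; apply/ffunP => i; rewrite !ffunE subnK //; case: eqP => // ->.
Qed.

Lemma subu_addu n i j : (0 < n i)%N -> subu (addu n j) i = addu (subu n i) j.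
Proof. by move=> n_gt0; rewrite -{1}(subuK n_gt0) adduC adduK. Qed.

Lemma mnorm_addu n j : mnorm (addu n j) = (mnorm n).+1.
Proof.
rewrite /mnorm (eq_bigr (fun i => n i + (i == j))%N) => [|i _]; last exact: adduE.
rewrite big_split /= (bigD1 (P := predT) (F := fun i => i == j : nat) j) //= eqxx.
by rewrite [X in (true + X)%N]big1 ?addn0 ?addn1 // => i /negPf->.
Qed.

Lemma mnorm_subu_le n j : (mnorm (subu n j) <= mnorm n)%N.
Proof. by apply: leq_sum => i _; rewrite ffunE leq_subr. Qed.

Lemma in_box_le N n m : (forall i, (n i <= m i)%N) -> in_box N m -> in_box N n.
Proof.
move=> le_nm box_m i; move: (box_m i); case: (N i) => //= ?.
exact: leq_trans.
Qed.

Lemma in_box_addu N n j : in_box N (addu n j) -> in_box N n.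
Proof. by apply: in_box_le => i; rewrite adduE leq_addr. Qed.

Lemma in_box_subu N n j : in_box N n -> in_box N (subu n j).
Proof. by apply: in_box_le => i; rewrite ffunE leq_subr. Qed.

Lemma in_box_adduP N n j :
  in_box N (addu n j) <-> in_box N n /\ lten (n j) (N j).
Proof.
split=> [box|[box lt_nN] i].
  split; first exact: in_box_addu box.
  by move: (box j); rewrite adduE eqxx addn1; case: (N j).
rewrite adduE; have [->|_] := eqVneq i j; last by rewrite addn0.
by rewrite addn1; case: (N j) lt_nN.
Qed.

Lemma lten_or_eq (p : nat) (M : enat) : leen p M -> lten p M \/ M = Some p.
Proof.
by case: M => [M|] /=; [rewrite leq_eqVlt => /predU1P[->|]; [right|left]|left].
Qed.

Definition axis j p : mindex r := [ffun i => if i == j then p else 0%N].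

Lemma axisE j p : axis j p j = p.
Proof. by rewrite ffunE eqxx. Qed.

Lemma axis_neq j p i : i != j -> axis j p i = 0%N.
Proof. by rewrite ffunE => /negPf->. Qed.

Lemma addu_axis j p : addu (axis j p) j = axis j p.+1.
Proof. by apply/ffunP => i; rewrite !ffunE; case: eqP; rewrite ?addn1. Qed.

Lemma subu_axis j p : subu (axis j p.+1) j = axis j p.
Proof. by rewrite -addu_axis adduK. Qed.

Lemma mnorm_axis j p : mnorm (axis j p) = p.
Proof.
rewrite /mnorm (bigD1 j) //= axisE big1 ?addn0 // => i.
exact: axis_neq.
Qed.

Lemma in_box_axis N j p : in_box N (axis j p) <-> leen p (N j).
Proof.
split=> [/(_ j)|le_pN i]; first by rewrite axisE.
by rewrite ffunE; case: eqP => [->|_] //; case: (N i).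
Qed.

Lemma mnorm0 : mnorm ([ffun=> 0%N] : mindex r) = 0%N.
Proof. by rewrite /mnorm big1 // => i _; rewrite ffunE. Qed.

Lemma mnorm_eq0 n : mnorm n = 0%N -> n = [ffun=> 0%N].
Proof.
move=> n0; apply/ffunP => i; rewrite ffunE; apply/eqP.
by rewrite -leqn0 -n0 /mnorm (bigD1 i) //= leq_addr.
Qed.

Lemma axis0 j : axis j 0 = [ffun=> 0%N].
Proof. by apply: mnorm_eq0; rewrite mnorm_axis. Qed.

(** The hypothesis covers every index of norm at most that of [n], since the step to [addu n j]
    involves [n] and all [subu n i]. *)
Lemma mindex_ind (Q : mindex r -> Prop) :
  Q [ffun=> 0%N] ->
  (forall n j, (forall m, (mnorm m <= mnorm n)%N -> Q m) -> Q (addu n j)) ->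
  forall n, Q n.
Proof.
move=> Q0 Qadd n; have [s] := ubnP (mnorm n); elim: s n => // s IHs n lt_ns.
case: (pickP (fun j => 0 < n j)%N) => [j n_gt0|n0]; last first.
  suff -> : n = [ffun=> 0%N] by [].
  by apply/ffunP => i; have := n0 i; rewrite ffunE; case: (n i).
rewrite -(subuK n_gt0); apply: Qadd => m le_m; apply: IHs.
by rewrite -(subuK n_gt0) mnorm_addu in lt_ns; exact: leq_ltn_trans le_m _.
Qed.

(** The distance from [n] to the axis of e_j; moves along that axis leave it unchanged. *)
Definition offaxis j n : nat := (\sum_(i | i != j) n i)%N.

Lemma offaxis_addu j n i : offaxis j (addu n i) = (offaxis j n + (i != j))%N.
Proof.
have := mnorm_addu n i; rewrite /mnorm !(bigD1 (P := predT) j) //= -!/(offaxis j _).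
rewrite adduE (eq_sym j); case: eqP => _ /=; rewrite ?addn1 ?addn0 ?addSn.
  by move=> [] /addnI.
by rewrite -addnS => /addnI.
Qed.

Lemma offaxis_subu j n i : (offaxis j (subu n i) <= offaxis j n)%N.
Proof. by apply: leq_sum => k _; rewrite ffunE leq_subr. Qed.

(** When passing to [addu n l], the hypothesis is available at [addu n j] as well as at [n],
    although the former has the same norm as the target. *)
Lemma offaxis_ind j (Q : mindex r -> Prop) :
  (forall p, Q (axis j p)) ->
  (forall n l, l != j ->
     (forall m, (offaxis j m <= offaxis j n)%N -> Q m) -> Q (addu n l)) ->
  forall n, Q n.
Proof.
move=> Qaxis Qadd n; have [s] := ubnP (offaxis j n); elim: s n => // s IHs n lt_ns.
case: (pickP (fun l => (l != j) && (0 < n l)%N)) => [l /andP[neq_lj n_gt0]|n0].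
  rewrite -(subuK n_gt0); apply: Qadd => // m le_m; apply: IHs.
  rewrite -(subuK n_gt0) offaxis_addu neq_lj addn1 in lt_ns.
  exact: leq_ltn_trans le_m _.
suff -> : n = axis j (n j) by [].
apply/ffunP => i; rewrite ffunE; case: eqP => [->//|/eqP neq_ij].
by have := n0 i; rewrite neq_ij; case: (n i).
Qed.

End MultiIndex.

(** * The nearest neighbour recurrence on lattice paths *)

Section NearestNeighbour.
Variables (K : fieldType) (r : nat) (a b : mindex r -> 'I_r -> K).
Implicit Types (n m : mindex r) (i j k l : 'I_r).

(** The recurrence solved for its top term. The family [P] is a parameter so that the same step
    serves the recursion with fuel and the consistency argument. *)
Definition nn_step (P : mindex r -> {poly K}) n j : {poly K} :=
  ('X - (b n j)%:P) * P n - \sum_(i < r) a n i *: P (subu n i).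

Fixpoint nn_poly_rec s n : {poly K} :=
  if s is s'.+1 then
    if [pick j | (0 < n j)%N] is Some j then
      nn_step (nn_poly_rec s') (subu n j) j
    else 1
  else 1.

(* The polynomials are computed along one arbitrary path from [0] to [n];
   [nn_polyE] says that all paths agree. *)
Definition nn_poly n := nn_poly_rec (mnorm n) n.

Lemma nn_poly_rec_fuel s t n : (mnorm n <= s)%N -> (mnorm n <= t)%N ->
  nn_poly_rec s n = nn_poly_rec t n.
Proof.
have rec0 u m : mnorm m = 0%N -> nn_poly_rec u m = 1.
  move=> /mnorm_eq0 ->; case: u => //= u.
  by case: pickP => // j; rewrite ffunE.
elim: s t n => [|s IHs] [|t] n le_ns le_nt //.
- by rewrite rec0 ?rec0 //; apply/eqP; rewrite -leqn0.
- by rewrite rec0 ?rec0 //; apply/eqP; rewrite -leqn0.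
rewrite /=; case: pickP => // j n_gt0; rewrite -(subuK n_gt0) mnorm_addu in le_ns le_nt.
rewrite /nn_step (IHs t) //; congr (_ - _); apply: eq_bigr => i _.
by rewrite (IHs t) //; exact: leq_trans (mnorm_subu_le _ _) _.
Qed.

Lemma nn_poly0 : nn_poly [ffun=> 0%N] = 1.
Proof. by rewrite /nn_poly mnorm0. Qed.

Lemma nn_poly_path n j : exists2 k : 'I_r,
  (0 < addu n j k)%N &
  nn_poly (addu n j) = nn_step nn_poly (subu (addu n j) k) k.
Proof.
rewrite /nn_poly mnorm_addu /=; case: pickP => [k n_gt0|/(_ j)]; last first.
  by rewrite adduE eqxx addn1.
have le_sub : (mnorm (subu (addu n j) k) <= mnorm n)%N.
  by rewrite -ltnS -(mnorm_addu _ k) subuK // mnorm_addu.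
exists k => //; rewrite /nn_step (nn_poly_rec_fuel le_sub (leqnn _)).
congr (_ - _); apply: eq_bigr => i _; congr (_ *: _); apply: nn_poly_rec_fuel => //.
exact: leq_trans (mnorm_subu_le _ _) le_sub.
Qed.

Variable N : 'I_r -> enat.

Hypothesis eq_b : forall n j l, j != l -> in_box N (addu (addu n j) l) ->
  b (addu n l) j - b (addu n j) l = b n j - b n l.
Hypothesis eq_ab : forall n j l, j != l -> in_box N (addu (addu n j) l) ->
  b n l * b (addu n l) j - b n j * b (addu n j) l
  = \sum_(i < r) a (addu n l) i - \sum_(i < r) a (addu n j) i.
Hypothesis eq_a : forall n j l, j != l -> (0 < n j)%N ->
  in_box N (addu n j) -> in_box N (addu n l) ->
  a (addu n l) j * (b (subu n j) j - b (subu n j) l)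
  = a n j * (b n j - b n l).
Hypothesis bnd0 : forall n j, in_box N n -> n j = 0%N -> a n j = 0.
Hypothesis bndN : forall n j, in_box N n -> N j = Some (n j) -> a n j = 0.

Section Consistency.
Variable P : mindex r -> {poly K}.
Variable n : mindex r.
Hypothesis P_step : forall m j, (mnorm m <= mnorm n)%N -> in_box N (addu m j) ->
  P (addu m j) = nn_step P m j.

Lemma nn_neighbour_diff m j l : (mnorm m <= mnorm n)%N ->
  in_box N (addu m j) -> in_box N (addu m l) ->
  P (addu m j) = P (addu m l) + (b m l - b m j) *: P m.
Proof.
move=> le_mn box_j box_l; rewrite !P_step // /nn_step -mul_polyC polyCB; ring.
Qed.

Lemma nn_shift_term j i : in_box N (addu n j) ->
  a (addu n j) i *: P (subu (addu n j) i) =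
  a (addu n j) i *: P n + (a n i * (b n i - b n j)) *: P (subu n i).
Proof.
move=> box_j; have box_n := in_box_addu box_j.
have [->|neq_ij] := eqVneq i j; first by rewrite adduK subrr mulr0 scale0r addr0.
have nj_i : addu n j i = n i by rewrite adduE (negPf neq_ij) addn0.
have [n_i0|n_gt0] := posnP (n i).
  by rewrite (bnd0 box_j) ?nj_i // (bnd0 box_n) // mul0r !scale0r addr0.
have [lt_ni|Ni] := lten_or_eq (box_n i); last first.
  by rewrite (bndN box_j) ?nj_i // (bndN box_n) // mul0r !scale0r addr0.
have box_i : in_box N (addu n i) by apply/in_box_adduP.
have box_sub l : in_box N (addu n l) -> in_box N (addu (subu n i) l).
  apply: in_box_le => k; rewrite !adduE leq_add2r ffunE; exact: leq_subr.
rewrite subu_addu // -eq_a // (@nn_neighbour_diff _ _ i) ?subuK //; last exact: box_sub.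
  by rewrite scalerDr scalerA.
exact: mnorm_subu_le.
Qed.

(* Once [P (addu n j)] is itself expanded by [P_step], the right-hand side is
   symmetric in [j] and [k] by [eq_b] and [eq_ab]. *)
Lemma nn_step_addu j k : in_box N (addu n j) ->
  nn_step P (addu n j) k =
  'X * P (addu n j) - b (addu n j) k *: P (addu n j)
  - (\sum_(i < r) a (addu n j) i) *: P n
  - \sum_(i < r) (a n i * b n i) *: P (subu n i)
  + b n j *: \sum_(i < r) a n i *: P (subu n i).
Proof.
move=> box_j; rewrite /nn_step mulrBl mul_polyC.
under eq_bigr do rewrite nn_shift_term //.
rewrite big_split /= -scaler_suml -!addrA; congr (_ + (_ + _)).
rewrite opprD; congr (_ + _); rewrite scaler_sumr -!sumrN -big_split /=.
apply: eq_bigr => i _; rewrite scalerA addrC -scalerBl -scaleNr; congr (_ *: _); ring.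
Qed.

Lemma nn_step_comm j k : j != k -> in_box N (addu (addu n j) k) ->
  nn_step P (addu n j) k = nn_step P (addu n k) j.
Proof.
move=> neq_jk box_jk; have box_j := in_box_addu box_jk.
have box_k : in_box N (addu n k) by rewrite adduC in box_jk; exact: in_box_addu box_jk.
have /eqP := eq_b neq_jk box_jk; rewrite subr_eq => /eqP bE.
have /eqP := eq_ab neq_jk box_jk; rewrite eq_sym subr_eq => /eqP aE.
rewrite !nn_step_addu // !P_step // /nn_step aE bE -!mul_polyC.
rewrite !(polyCD, polyCM, polyCB, polyCN); ring.
Qed.

End Consistency.

(** The chosen path enters [addu n j] in some direction [k]. If [k != j], the square based at
    [subu n k] commutes, and its lower steps are covered by induction on the norm. *)
Lemma nn_polyE n j : in_box N (addu n j) ->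
  nn_poly (addu n j) = nn_step nn_poly n j.
Proof.
have [s] := ubnP (mnorm n); elim: s n j => // s IHs n j lt_ns box_j.
have [k nj_gt0 ->] := nn_poly_path n j.
have [->|neq_kj] := eqVneq k j; first by rewrite adduK.
have n_gt0 : (0 < n k)%N by move: nj_gt0; rewrite adduE (negPf neq_kj) addn0.
rewrite subu_addu // -{2}(subuK n_gt0).
apply: nn_step_comm; rewrite 1?eq_sym //; last by rewrite adduC subuK.
move=> m l le_m; apply: IHs; apply: leq_ltn_trans le_m _.
by rewrite -ltnS -(mnorm_addu _ k) subuK.
Qed.

Lemma nn_recurrence n j : in_box N (addu n j) ->
  'X * nn_poly n = nn_poly (addu n j) + b n j *: nn_poly n
                   + \sum_(i < r) a n i *: nn_poly (subu n i).
Proof. by move=> box_j; rewrite nn_polyE // /nn_step -mul_polyC; ring. Qed.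

Lemma nn_poly_unique (P : mindex r -> {poly K}) : P [ffun=> 0%N] = 1 ->
  (forall n j, in_box N (addu n j) ->
     'X * P n = P (addu n j) + b n j *: P n
                + \sum_(i < r) a n i *: P (subu n i)) ->
  forall n, in_box N n -> P n = nn_poly n.
Proof.
move=> P0 P_rec; elim/mindex_ind => [|n j IHn box_j]; first by rewrite P0 nn_poly0.
have box_n := in_box_addu box_j.
rewrite nn_polyE // /nn_step -(IHn n) //.
rewrite [\sum__ _](eq_bigr (fun i => a n i *: P (subu n i))); last first.
  by move=> i _; rewrite (IHn (subu n i)) ?mnorm_subu_le //; exact: in_box_subu.
by rewrite mulrBl (P_rec n j) // mul_polyC addrAC addrK addrK.
Qed.

Lemma nn_poly_monic_size n : in_box N n ->
  nn_poly n \is monic /\ size (nn_poly n) = (mnorm n).+1.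
Proof.
elim/mindex_ind: n => [|n j IHn box_j].
  by rewrite nn_poly0 monic1 size_poly1 mnorm0.
have box_n := in_box_addu box_j.
have [mon_n size_n] := IHn n (leqnn _) box_n.
have mon : ('X - (b n j)%:P) * nn_poly n \is monic.
  by rewrite monicMl ?monicXsubC.
have sz : size (('X - (b n j)%:P) * nn_poly n) = (mnorm n).+2.
  by rewrite size_monicM ?monicXsubC ?monic_neq0 // size_XsubC size_n.
have lt_sz : (size (- \sum_(i < r) a n i *: nn_poly (subu n i))%R <
    size (('X - (b n j)%:P) * nn_poly n)%R)%N.
  rewrite sz size_polyN ltnS (leq_trans (size_sum _ _ _)) //.
  apply/bigmax_leqP => i _; rewrite (leq_trans (size_scale_leq _ _)) //.
  have [_ ->] := IHn _ (mnorm_subu_le n i) (in_box_subu i box_n).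
  by rewrite ltnS mnorm_subu_le.
rewrite nn_polyE // mnorm_addu /nn_step; split.
  by rewrite monicE lead_coefDl // -monicE.
by rewrite size_polyDl.
Qed.

(** * Orthogonality carried from an axis to the box *)

Section AxisFunctional.
Hypothesis N_ge1 : forall j, lten 0 (N j).
Variable j : 'I_r.

(** The cutoff is strict because [b (axis j p) j] is given only for p < N_j; at p = N_j the zero
    value makes the recurrence terminate. *)
Definition axis_alpha p : K := if lten p (N j) then a (axis j p) j else 0.
Definition axis_beta p : K := if lten p (N j) then b (axis j p) j else 0.

Lemma axis_alpha_end p : N j = Some p -> axis_alpha p = 0.
Proof. by rewrite /axis_alpha => -> /=; rewrite ltnn. Qed.

(** On the axis [bnd0] removes every term with [i != j], which leaves three terms. *)
Lemma nn_poly_axis p : leen p (N j) ->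
  nn_poly (axis j p) = three_term axis_alpha axis_beta p.
Proof.
have step q : lten q (N j) -> nn_poly (axis j q.+1) =
    ('X - (b (axis j q) j)%:P) * nn_poly (axis j q) -
    a (axis j q) j *: nn_poly (subu (axis j q) j).
  move=> lt_qN; have box_q : in_box N (axis j q).
    by apply/in_box_axis; move: lt_qN; case: (N j) => //= M /ltnW.
  rewrite -addu_axis nn_polyE; last by apply/in_box_adduP; rewrite axisE.
  rewrite /nn_step (bigD1 j) //= big1 ?addr0 // => i neq_ij.
  by rewrite bnd0 ?scale0r ?axis_neq.
suff: (leen p (N j) -> nn_poly (axis j p) = three_term axis_alpha axis_beta p) /\
  (leen p.+1 (N j) -> nn_poly (axis j p.+1) = three_term axis_alpha axis_beta p.+1).
  by case.
elim: p => [|p [IHp IHp1]].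
  split=> [_|le_1N]; first by rewrite axis0 nn_poly0.
  rewrite step ?N_ge1 // bnd0 ?axisE //; last by apply/in_box_axis; case: (N j).
  by rewrite scale0r /= scaler0 /axis_beta N_ge1 axis0 nn_poly0.
split=> // le_pN; have lt_pN : lten p.+1 (N j) by move: le_pN; case: (N j).
have le_p1N : leen p.+1 (N j) by move: le_pN; case: (N j) => //= M /ltnW.
have le_p0N : leen p (N j) by move: le_p1N; case: (N j) => //= M /ltnW.
rewrite step // subu_axis IHp1 // IHp //.
by rewrite [three_term _ _ p.+2]/= /axis_alpha /axis_beta lt_pN.
Qed.

Variable f : {scalar {poly K}}.
Hypothesis f_axis : forall p, f (three_term axis_alpha axis_beta p.+1) = 0.

(** On the face n_j = N_j there is no neighbour [addu n j] in the box to compare with. The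
    recurrence in a direction [l != j] is used instead: [bndN] removes its term in [subu n j], so it
    stays on the face. *)
Lemma nn_annihilated n q : in_box N n -> N j = Some (n j) ->
  f (nn_poly n * 'X^q) = 0.
Proof.
elim/(offaxis_ind (j := j)): n q => [p|n l neq_lj IHn] q.
  rewrite axisE => /in_box_axis le_pN Nj; rewrite nn_poly_axis //.
  apply: (@three_term_terminates _ _ _ _ f_axis p); last exact: axis_alpha_end.
  by move: (N_ge1 j); rewrite Nj /= leqnn andbT.
rewrite adduE eq_sym (negPf neq_lj) addn0 => box_l Nj.
have box_n := in_box_addu box_l.
rewrite nn_polyE // /nn_step mulrBl mulrBl mulrBl mulr_suml !linearB linear_sum.
rewrite -mulrA mulrCA -exprS mul_polyC -scalerAl linearZ /= !IHn // mulr0 subr0.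
rewrite big1 ?subr0 // => i _; rewrite -scalerAl linearZ /=.
have [->|neq_ij] := eqVneq i j; first by rewrite bndN // mul0r.
rewrite IHn ?mulr0 ?offaxis_subu //; first exact: in_box_subu.
by rewrite ffunE eq_sym (negPf neq_ij) subn0.
Qed.

Lemma nn_poly_diff n l : in_box N (addu n j) -> in_box N (addu n l) ->
  nn_poly (addu n l) = nn_poly (addu n j) + (b n j - b n l) *: nn_poly n.
Proof.
move=> box_j box_l; apply: (nn_neighbour_diff (n := n)) => // m i _.
exact: nn_polyE.
Qed.

Lemma nn_orthogonal n q : in_box N n -> (q < n j)%N ->
  f (nn_poly n * 'X^q) = 0.
Proof.
elim/(offaxis_ind (j := j)): n q => [p|n l neq_lj IHn] q.
  rewrite axisE => /in_box_axis le_pN lt_qp; rewrite nn_poly_axis //.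
  exact: three_term_orthogonal.
move=> box_l; have nl_j : addu n l j = n j.
  by rewrite adduE eq_sym (negPf neq_lj) addn0.
rewrite nl_j => lt_qn; have box_n := in_box_addu box_l.
have [lt_nN|Nj] := lten_or_eq (box_n j); last first.
  by apply: nn_annihilated; rewrite ?nl_j.
have box_j : in_box N (addu n j) by apply/in_box_adduP.
rewrite nn_poly_diff // mulrDl linearD -scalerAl linearZ /= !IHn ?mulr0 ?addr0 //.
  by rewrite offaxis_addu eqxx addn0.
by rewrite adduE (leq_trans lt_qn) // leq_addr.
Qed.

Hypothesis nrm_a : forall n i, in_box N n -> (0 < n i)%N ->
  lten (n i) (N i) -> a n i != 0.
Hypothesis nrm_b : forall n i k, i != k ->
  in_box N (addu n i) -> in_box N (addu n k) -> b n i - b n k != 0.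
Hypothesis f1 : f 1 != 0.

(** On the axis the value is a product of nonzero [a]. Off it, orthogonality kills the [addu n j]
    term of [nn_poly_diff], and each step contributes a factor that is nonzero by [nrm_b]. *)
Lemma nn_diagonal_neq0 n : in_box N (addu n j) -> f (nn_poly n * 'X^(n j)) != 0.
Proof.
elim/(offaxis_ind (j := j)): n => [p|n l neq_lj IHn].
  rewrite addu_axis axisE => /in_box_axis le_pN.
  have le_N q : (q <= p)%N -> lten q (N j).
    by move=> le_qp; move: le_pN; case: (N j) => //= M; apply: leq_ltn_trans.
  have box_q q : (q <= p)%N -> in_box N (axis j q).
    by move/le_N => lt_qN; apply/in_box_axis; move: lt_qN; case: (N j) => //= M /ltnW.
  rewrite nn_poly_axis; last exact/in_box_axis/box_q.
  rewrite three_term_diagonal // mulf_neq0 //; apply/prodf_neq0 => i _.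
  by rewrite /axis_alpha le_N // nrm_a ?axisE ?le_N //; exact: box_q.
move=> box_lj; have box_l := in_box_addu box_lj.
have box_j : in_box N (addu n j) by rewrite adduC in box_lj; exact: in_box_addu box_lj.
have -> : addu n l j = n j by rewrite adduE eq_sym (negPf neq_lj) addn0.
rewrite nn_poly_diff // mulrDl linearD -scalerAl linearZ /= nn_orthogonal //.
  by rewrite add0r mulf_neq0 ?IHn // nrm_b // eq_sym.
by rewrite adduE eqxx addn1.
Qed.

End AxisFunctional.

End NearestNeighbour.

(** * Normality and multiple orthogonal polynomials *)

Section MultipleOrthogonality.
Variables (R : realType) (r : nat).
Implicit Types (mu : 'I_r -> {scalar {poly R[i]}}) (N : 'I_r -> enat).
Implicit Types (n : mindex r) (P Q : {poly R[i]}).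

Lemma mop_orthogonalBZ mu n P Q c : mop_orthogonal mu n P ->
  mop_orthogonal mu n Q -> mop_orthogonal mu n (P - c *: Q).
Proof.
move=> oP oQ j p lt_pn.
by rewrite mulrBl -scalerAl linearB linearZ /= oP // oQ // mulr0 subr0.
Qed.

Lemma normal_index_eq mu n P Q : normal_index mu n -> P \is monic ->
  size P = (mnorm n).+1 -> mop_orthogonal mu n P ->
  size Q = (mnorm n).+1 -> mop_orthogonal mu n Q -> Q = lead_coef Q *: P.
Proof.
move=> normal_n monP sizeP oP sizeQ oQ; apply/eqP; rewrite -subr_eq0.
apply/negPn/negP => D_neq0.
have Q_neq0 : Q != 0 by rewrite -size_poly_gt0 sizeQ.
have := size_sub_monic Q_neq0 monP; rewrite sizeP sizeQ => /(_ erefl) lt_D.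
have := normal_n _ D_neq0 (ltnW lt_D) (mop_orthogonalBZ _ oQ oP).
by move=> eq_D; rewrite eq_D ltnn in lt_D.
Qed.

(** A polynomial of too low degree that is orthogonal at [addu n j] is orthogonal at [n], hence a
    nonzero multiple of [P n]; the remaining condition, on ['X^(n j)], then fails. *)
Lemma normal_index_diagonal mu N (P : mindex r -> {poly R[i]}) :
  (forall n, in_box N n -> [/\ P n \is monic, size (P n) = (mnorm n).+1
                            & mop_orthogonal mu n (P n)]) ->
  (forall n j, in_box N (addu n j) -> mu j (P n * 'X^(n j)) != 0) ->
  forall n, in_box N n -> normal_index mu n.
Proof.
move=> P_mop P_diag; elim/mindex_ind => [_|n j IHn box_j] Q Q_neq0.
  rewrite mnorm0 => le_Q _; apply/eqP.
  by rewrite eqn_leq le_Q size_poly_gt0.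
rewrite mnorm_addu leq_eqVlt => /predU1P[//|]; rewrite ltnS => le_Q oQ.
have box_n := in_box_addu box_j; have normal_n := IHn n (leqnn _) box_n.
have [monP sizeP oP] := P_mop n box_n.
have oQn : mop_orthogonal mu n Q.
  by move=> i p lt_p; apply: oQ; rewrite adduE (leq_trans lt_p) // leq_addr.
have sizeQ := normal_n Q Q_neq0 le_Q oQn.
have /eqP : mu j (Q * 'X^(n j)) = 0 by apply: oQ; rewrite adduE eqxx addn1.
rewrite (normal_index_eq normal_n monP sizeP oP sizeQ oQn) -scalerAl linearZ /=.
by rewrite mulf_eq0 lead_coef_eq0 (negPf Q_neq0) (negPf (P_diag n j box_j)).
Qed.

Lemma mop_eq mu n P : normal_index mu n -> P \is monic ->
  size P = (mnorm n).+1 -> mop_orthogonal mu n P -> mop mu n = P.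
Proof.
move=> normal_n monP sizeP oP; apply: xget_unique => // Q [monQ sizeQ oQ].
by rewrite (normal_index_eq normal_n monP sizeP oP sizeQ oQ) (monicP monQ) scale1r.
Qed.

Lemma mop0 mu : mop mu [ffun=> 0%N] = 1.
Proof.
apply: mop_eq; rewrite ?monic1 ?size_poly1 ?mnorm0 //.
  by move=> P P_neq0 le_P _; apply/eqP; rewrite eqn_leq le_P mnorm0 size_poly_gt0.
by move=> j p; rewrite ffunE.
Qed.

(** Being nonzero rules out the default value of [xget], so the defining set is inhabited. *)
Lemma mop_neq0_orthogonal mu n : mop mu n != 0 -> mop_orthogonal mu n (mop mu n).
Proof. by rewrite /mop; case: xgetP => [P _ [] //|_]; rewrite eqxx. Qed.

(** Normality of [axis j k] makes the Hankel determinant of order [k] nonzero; beyond a finite [M],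
    the annihilated polynomial lies in the kernel of every larger Hankel matrix. *)
Lemma in_L_axis N mu j : (forall n, in_box N n -> normal_index mu n) ->
  (forall M, N j = Some M -> exists P,
     [/\ P != 0, size P = M.+1 & forall p, mu j (P * 'X^p) = 0]) ->
  in_L (N j) (mu j).
Proof.
move=> normal muP.
have hankel_neq0 k : leen k (N j) -> hankel_det (mu j) k != 0.
  move/in_box_axis/normal => normal_k; apply/eqP => /hankel_det_eq0P[Q [Q_neq0 le_Q muQ]].
  have := normal_k Q Q_neq0; rewrite mnorm_axis => /(_ (leqW le_Q)) sizeQ.
  move: le_Q; rewrite sizeQ ?ltnn // => i p.
  by have [->|neq_ij] := eqVneq i j; [rewrite axisE => /muQ|rewrite axis_neq].
rewrite /in_L; case Nj : (N j) hankel_neq0 => [M|] hankel_neq0.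
  split=> [k /andP[_ le_k]|k lt_k]; first exact: hankel_neq0.
  have [P [P_neq0 sizeP annP]] := muP M Nj.
  by apply/hankel_det_eq0P; exists P; rewrite sizeP.
by move=> k; apply: hankel_neq0.
Qed.

End MultipleOrthogonality.

(** Rescaling a functional by a nonzero constant preserves orthogonality and the vanishing of Hankel
    determinants, so uniqueness is stated up to a factor [c j] for each [j]. *)
Theorem theorem3p19 (R : realType) (r : nat) (r_ge1 : (1 <= r)%N)
    (N : 'I_r -> enat) (N_ge1 : forall j, lten 0 (N j))
    (a b : mindex r -> 'I_r -> R[i])
    (eq_b : forall (n : mindex r) (j l : 'I_r), j != l -> in_box N (addu (addu n j) l) ->
       b (addu n l) j - b (addu n j) l = b n j - b n l)
    (eq_ab : forall (n : mindex r) (j l : 'I_r), j != l -> in_box N (addu (addu n j) l) ->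
       b n l * b (addu n l) j - b n j * b (addu n j) l
       = \sum_(i < r) a (addu n l) i - \sum_(i < r) a (addu n j) i)
    (eq_a : forall (n : mindex r) (j l : 'I_r), j != l -> (0 < n j)%N ->
       in_box N (addu n j) -> in_box N (addu n l) ->
       a (addu n l) j * (b (subu n j) j - b (subu n j) l)
       = a n j * (b n j - b n l))
    (bnd0 : forall (n : mindex r) (j : 'I_r), in_box N n -> n j = 0%N -> a n j = 0)
    (bndN : forall (n : mindex r) (j : 'I_r), in_box N n -> N j = Some (n j) -> a n j = 0)
    (nrm_a : forall (n : mindex r) (j : 'I_r), in_box N n -> (0 < n j)%N -> lten (n j) (N j) ->
       a n j != 0)
    (nrm_b : forall (n : mindex r) (j k : 'I_r), j != k ->
       in_box N (addu n j) -> in_box N (addu n k) -> b n j - b n k != 0) :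
  exists mu : 'I_r -> {scalar {poly R[i]}},
    (perfect_system N mu /\ nn_coefficients N mu a b) /\
    (forall nu : 'I_r -> {scalar {poly R[i]}},
       perfect_system N nu -> nn_coefficients N nu a b ->
       exists2 c : 'I_r -> R[i], (forall j, c j != 0) &
         forall j P, nu j P = c j * mu j P).
Proof.
pose al j := axis_alpha a N j; pose be j := axis_beta b N j.
(* The coefficient of [three_term 0]: it kills all later axis polynomials and is normalised by
   [mu j 1 = 1]. *)
pose mu j := dual_functional (al j) (be j) 0.
have mu_axis j p : mu j (three_term (al j) (be j) p.+1) = 0.
  exact: dual_functional_three_term.
have mu1 j : mu j 1 = 1 by exact: (dual_functional_three_term _ _ 0 0).
have P_mop n : in_box N n -> [/\ nn_poly a b n \is monic,
    size (nn_poly a b n) = (mnorm n).+1 & mop_orthogonal mu n (nn_poly a b n)].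
  move=> box_n; have [mon sz] :=
    nn_poly_monic_size eq_b eq_ab eq_a bnd0 bndN box_n.
  split=> // j p lt_p.
  exact: (nn_orthogonal eq_b eq_ab eq_a bnd0 bndN N_ge1 (mu_axis j)).
have normal_mu n : in_box N n -> normal_index mu n.
  apply: (normal_index_diagonal P_mop) => {}n j.
  by apply: (nn_diagonal_neq0 eq_b eq_ab eq_a bnd0 bndN N_ge1 (mu_axis j) nrm_a nrm_b);
    rewrite mu1 oner_neq0.
have mop_mu n : in_box N n -> mop mu n = nn_poly a b n.
  move=> box_n; have [mon sz oP] := P_mop n box_n.
  exact: (mop_eq (normal_mu n box_n)).
exists mu; split; first split.
- split=> // j.
  apply: in_L_axis => // M Nj; have box_M : in_box N (axis j M).
    by apply/in_box_axis; rewrite Nj /=.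
  have [mon sz _] := P_mop _ box_M; exists (nn_poly a b (axis j M)).
  rewrite monic_neq0 // sz mnorm_axis; split=> // p.
  by apply: (nn_annihilated eq_b eq_ab eq_a bnd0 bndN N_ge1 (mu_axis j)); rewrite ?axisE.
- split=> [n j box_j|n i|n Nn i].
  + have box_n := in_box_addu box_j.
    rewrite (mop_mu n) // (mop_mu (addu n j)) //.
    under [in RHS]eq_bigr do rewrite (mop_mu _ (in_box_subu _ box_n)).
    exact: (nn_recurrence eq_b eq_ab eq_a bnd0 bndN).
  + exact: bnd0.
  + by apply: bndN => // j; rewrite Nn /=.
move=> nu [nu_L normal_nu] [nu_rec _ _].
have mop_nu n : in_box N n -> mop nu n = nn_poly a b n.
  by apply: (nn_poly_unique eq_b eq_ab eq_a bnd0 bndN (mop0 nu)) => m j /nu_rec.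
have nu_orth n : in_box N n -> mop_orthogonal nu n (nn_poly a b n).
  move=> box_n; rewrite -mop_nu //; apply: mop_neq0_orthogonal.
  by have [mon _ _] := P_mop n box_n; rewrite mop_nu // monic_neq0.
(* The Hankel determinant of order 1 is the zeroth moment, and it is nonzero because N_j is at least
   1. *)
have nu1 j : nu j 1 != 0.
  have hankel1 : hankel_det (nu j) 1 != 0.
    by move: (nu_L j) (N_ge1 j); rewrite /in_L; case: (N j) => [M [+ _] M_gt0|//]; apply.
  apply: contra hankel1 => /eqP nu1; apply/eqP/hankel_det_eq0P.
  exists 1; rewrite oner_neq0 size_poly1; split=> // p.
  by rewrite ltnS leqn0 => /eqP ->; rewrite expr0 mulr1.
(* The normalisation [mu j 1 = 1] forces this factor; both functionals vanish on all later axis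
   polynomials. *)
exists (fun j => nu j 1) => // j; pose t := three_term (al j) (be j).
have nu_axis k p : leen k (N j) -> (p < k)%N -> nu j (t k * 'X^p) = 0.
  move=> le_kN lt_pk; have box_k : in_box N (axis j k) by apply/in_box_axis.
  have := nu_orth _ box_k j p; rewrite axisE => /(_ lt_pk).
  by rewrite (nn_poly_axis eq_b eq_ab eq_a bnd0 bndN).
have nu_t k : nu j (t k.+1) = 0.
  have [le_kN|] := boolP (leen k.+1 (N j)).
    by have := @nu_axis k.+1 0%N le_kN isT; rewrite expr0 mulr1.
  (* Beyond the box no orthogonality is given, but membership in L_M makes [nu j] annihilate all
     multiples of [t M], and the zero continuation passes this on to later indices. *)
  case Nj : (N j) => [M|]; rewrite /leen // -ltnNge => lt_Mk.
  have annM p : nu j (t M * 'X^p) = 0.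
    have LM : in_L (Some M) (nu j) by rewrite -Nj.
    apply: (in_L_annihilated LM).
    - exact: three_term_monic.
    - exact: size_three_term.
    - by move=> q; apply: nu_axis; rewrite Nj /=.
  have -> : t k.+1 = t k.+1 * 'X^0 by rewrite expr0 mulr1.
  by apply: three_term_annihilated annM _ _ (ltnW lt_Mk); exact: axis_alpha_end.
apply: (@proportional_on_three_term _ (al j) (be j)) => -[|k].
  by rewrite mu1 mulr1.
by rewrite mu_axis mulr0 nu_t.
Qed.
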